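(* Every Hausdorff monotonically normal cellular-Lindelöf first-countable space has cardinality at most $\mathfrak{c}$.
   Context: Here $\mathfrak{c}=2^{\aleph_0}$ is the cardinality of the continuum. A cellular family in a topological space $X$ is a family of pairwise disjoint non-empty open subsets of $X$. A space $X$ is called cellular-Lindelöf if for every cellular family $\mathcal{U}$ in $X$ there is a Lindelöf subspace $L$ of $X$ such that $U \cap L \neq \emptyset$ for every $U \in \mathcal{U}$. For a topological space $(X,\tau)$, let $\mathcal{U}(X)$ be the set of all pairs $(x,U)$ where $U$ is open in $X$ and $x \in U$. The space $(X,\tau)$ is called monotonically normal if there exists an operator $H: \mathcal{U}(X) \to \tau$ such that: (1) $x \in H(x,U) \subset U$ for every $(x,U) \in \mathcal{U}(X)$; (2) for all $(x,U),(y,V)\in\mathcal{U}(X)$, if $H(x,U) \cap H(y,V) \neq \emptyset$ then $x \in V$ or $y \in U$. *)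

(* Defs.v *)
From mathcomp Require Import all_boot all_classical topology.

Set Implicit Arguments.
Unset Strict Implicit.
Unset Printing Implicit Defensive.

Local Open Scope classical_set_scope.

Section CellularLindelof.
Variable X : topologicalType.
Implicit Types (L : set X) (F : set (set X)).

Definition cellular F :=
  (forall U, F U -> open U /\ U !=set0) /\ trivIset F id.

(* [L] is a Lindelof space for the subspace topology, whose open sets are the
   traces [L `&` G] of the open sets [G] of [X].  The library's type
   [subspace L] cannot be used for this: its carrier is all of [X], and the
   points outside [L] are isolated in it. *)
Definition lindelof_subspace L :=
  forall F, F `<=` [set L `&` G | G in open] -> L `<=` \bigcup_(V in F) V ->
    exists F', [/\ F' `<=` F, countable F' & L `<=` \bigcup_(V in F') V].

Definition cellular_lindelof :=
  forall F, cellular F ->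
    exists2 L, lindelof_subspace L & forall U, F U -> U `&` L !=set0.

(* [H] is a total function, but only its values at the pairs [(x, U)] with
   [U] open and [x] in [U] are constrained. *)
Definition monotonically_normal :=
  exists H : X -> set X -> set X,
    (forall x U, open_nbhs x U -> [/\ open (H x U), H x U x & H x U `<=` U]) /\
    (forall x U y V, open_nbhs x U -> open_nbhs y V ->
       H x U `&` H y V !=set0 -> V x \/ U y).

Definition first_countable :=
  forall x : X, exists2 B : set (set X),
    countable B & B `<=` open_nbhs x /\ filter_from B id --> x.

End CellularLindelof.

Arguments cellular_lindelof : clear implicits.
Arguments monotonically_normal : clear implicits.
Arguments first_countable : clear implicits.

(* Main.v *)
(* The space is in fact Lindelof, so that Arhangelskii's theorem applies.

   Closures of countable sets in a monotonically normal space are Lindelof.  If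
   an open cover of the whole space had no countable subcover, a recursion
   along omega_1 would produce an increasing sequence of open sets, each a
   countable union of shrunk members of the cover, and points x_i whose initial
   segments have closures inside these sets, while x_i is outside the closure of
   the previous ones.  The shrunk neighbourhoods of the x_i form a cellular
   family.  By first countability, the closure of the set of all x_i is covered
   by the sequence, so a Lindelof set meeting every member of the family would
   do so within a countable stage, which is impossible. *)
Require Import Defs.
From mathcomp Require Import all_boot all_classical topology wochoice.

Set Implicit Arguments.
Unset Strict Implicit.
Unset Printing Implicit Defensive.

Local Open Scope classical_set_scope.
Local Open Scope card_scope.

(** * Countable sets and recursion along omega_1 *)

Lemma countableU (T : Type) (A B : set T) :
  countable A -> countable B -> countable (A `|` B).
Proof.
move=> cA cB; rewrite -bigcup2inE; apply: bigcup_countable => // -[|[|n]] //=.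
Qed.

Definition omega1_order (I : Type) (lt : I -> I -> Prop) :=
  [/\ well_founded lt, forall i j k, lt i j -> lt j k -> lt i k,
      forall i j, [\/ lt i j, i = j | lt j i],
      ~ countable [set: I] & forall i, countable [set j | lt j i]].

Lemma well_founded_minimal (I : Type) (lt : I -> I -> Prop) (A : set I) :
  well_founded lt -> A !=set0 ->
  exists2 i, A i & forall j, A j -> ~ lt j i.
Proof.
move=> wf [a Aa]; apply: contrapT => noMin.
move: a Aa; apply: (well_founded_ind wf) => a IH Aa.
by apply: noMin; exists a => // j Aj /IH.
Qed.

(** Cantor's diagonal argument, run on a left inverse [g] of a supposed injection [f]. *)
Lemma uncountable_set_nat : ~ countable [set: set nat].
Proof.
move=> /countable_injP[f finj].
have [g gK] : exists g, forall A, g (f A) = A.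
  exists (fun n => xget set0 [set A | f A = n]) => A.
  by apply: finj; rewrite ?in_setT//; exact: (@xgetI _ _ [set B | f B = f A] A).
have gA := gK [set n | ~ g n n].
set A := [set n | ~ g n n] in gA.
have AP n : A n <-> ~ g n n by [].
by case: (AP (f A)); rewrite gA => ? ?; tauto.
Qed.

(** In a well-order of [set nat], either all proper initial segments are countable, or the segment
    below the least [a] whose segment is uncountable has the required type. *)
Lemma omega1_exists : exists I lt, @omega1_order I lt.
Proof.
have [R Rwo] := well_ordering_principle (set nat).
have Rmin (A : set (set nat)) : A !=set0 ->
    exists2 z, A z & forall x, A x -> R z x.
  move=> [a Aa]; have [|z [[/asboolP Az zmin] _]] := Rwo [pred x | `[< A x >]].
    by exists a; exact/asboolP.
  by exists z => // x Ax; apply: zmin; exact/asboolP.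
(* [Rwo] gives each non-empty set a unique least element; the order laws follow from sets of two or
   three elements. *)
have Rtot x y : R x y \/ R y x.
  have [|z [] -> zmin] := Rmin [set x; y]; first by exists x; left.
    by left; apply: zmin; right.
  by right; apply: zmin; left.
have Rrefl x : R x x by case: (Rtot x x).
have Ranti : antisymmetric R.
  move=> x y /andP[xy yx]; have [|z [_ zuniq]] := Rwo (pred2 x y).
    by exists x; rewrite inE eqxx.
  rewrite -(zuniq x) ?(zuniq y)//; split; rewrite ?inE ?eqxx ?orbT// => u.
    by rewrite inE => /orP[] /eqP ->.
  by rewrite inE => /orP[] /eqP ->.
have Rtrans x y z : R x y -> R y z -> R x z.
  move=> xy yz; have [|t [[]|] -> tmin] := Rmin [set x; y; z].
  - by exists x; left; left.
  - by apply: tmin; right.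
  - suff -> : x = y by [].
    by apply: Ranti; rewrite xy tmin//; left; left.
  - suff <- : y = z by [].
    by apply: Ranti; rewrite yz tmin//; left; right.
pose lt x y := R x y /\ x <> y.
have lt_trans x y z : lt x y -> lt y z -> lt x z.
  move=> [xy nxy] [yz nyz]; split; first exact: Rtrans yz.
  by move=> xz; apply: nxy; apply: Ranti; rewrite xy xz yz.
have lt_tri x y : [\/ lt x y, x = y | lt y x].
  have [->|nxy] := pselect (x = y); first by constructor 2.
  by case: (Rtot x y) => h; [constructor 1 | constructor 3]; split=> // /esym.
have lt_wf : well_founded lt.
  move=> a; apply: contrapT => nAcc.
  have [|m nm mmin] := Rmin [set x | ~ Acc lt x]; first by exists a.
  apply: nm; constructor => y [ym yNm]; apply: contrapT => /mmin my.
  by apply: yNm; apply: Ranti; rewrite ym my.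
have [all_count|] := pselect (forall i, countable [set j | lt j i]).
  by exists (set nat), lt; split=> //; exact: uncountable_set_nat.
move=> /existsNP/(well_founded_minimal lt_wf)[a aunc amin].
exists {x | lt x a}, (fun x y => lt (sval x) (sval y)); split.
- case; apply: (well_founded_ind lt_wf) => x IH xa.
  by constructor=> -[y ya] /= yx; exact: IH.
- by move=> x y z; exact: lt_trans.
- move=> x y; case: (lt_tri (sval x) (sval y)) => h.
  + by constructor 1.
  + by constructor 2; case: x y h => x ? [y ?] /= h; exact: eq_exist.
  + by constructor 3.
- move=> cnt; apply: aunc; apply: sub_countable cnt.
  apply: card_le_trans (card_image_le (fun x : {x | lt x a} => sval x) setT).
  by apply: subset_card_le => x xa; exists (exist _ x xa).
- move=> [x xa] /=.
  have /contrapT/countable_injP[f finj] : ~ ~ countable [set y | lt y x].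
    by move=> /amin; exact.
  apply/countable_injP; exists (fun y => f (sval y)) => -[y ya] [z za].
  rewrite !inE /= => yx zx /finj; rewrite !inE => /(_ yx zx) yz.
  exact: eq_exist.
Qed.

Lemma omega1_recursion (I T : Type) (lt : I -> I -> Prop)
    (P : set T -> T -> Prop) :
  omega1_order lt -> (forall S, countable S -> exists t, P S t) ->
  exists f : I -> T, forall i, P (f @` [set j | lt j i]) (f i).
Proof.
move=> [wf _ _ _ segment_countable] /= step.
(* [t0] is a default for uncountable [S], which never occur as sets of earlier values. *)
have [t0 _] := step set0 (@countable0 T).
have /boolp.choice[c cP] : forall S, exists t, countable S -> P S t.
  move=> S.
  have [/step[t Pt]|nS] := pselect (countable S); first by exists t.
  by exists t0.
pose F i (rec : forall j, lt j i -> T) :=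
  c [set t | exists j (ji : lt j i), rec j ji = t].
exists (Fix wf (fun=> T) F) => i; rewrite Fix_eq; last first.
  move=> j f g fg; congr F.
  by apply: functional_extensionality_dep => k;
     apply: functional_extensionality_dep.
set f := Fix wf (fun=> T) F; rewrite /F.
have -> : [set t | exists j (_ : lt j i), f j = t] = f @` [set j | lt j i].
  apply/seteqP; split=> t [j]; first by move=> [ji <-]; exists j.
  by move=> ji <-; exists j, ji.
apply: cP; apply: sub_countable (segment_countable i).
exact: card_image_le.
Qed.

(** Otherwise [I] would be the union, over the countably many [s] in [S], of the countable sets of
    indices up to [s]. *)
Lemma countable_bounded (I : Type) (lt : I -> I -> Prop) (S : set I) :
  omega1_order lt -> countable S -> exists i, forall s, S s -> lt s i.
Proof.
move=> [_ _ tri unc segment_countable] cS; apply: contrapT => /forallNP unb.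
apply: unc.
have cU : countable (\bigcup_(s in S) ([set j | lt j s] `|` [set s])).
  by apply: bigcup_countable => // s _; apply/countableU => //.
apply: sub_countable cU; apply: subset_card_le => i _.
have /existsNP[s /not_implyP[Ss nsi]] := unb i.
exists s => //; case: (tri i s) => //; first by left.
by right.
Qed.

Lemma uncountable_fiber (I T : Type) (C : set T) (c : I -> T) :
  ~ countable [set: I] -> countable C -> (forall i, C (c i)) ->
  exists t, ~ countable [set i | c i = t].
Proof.
move=> unc cC Cc; apply: contrapT => /forallNP h; apply: unc.
apply: (@sub_countable _ _ _ (\bigcup_(t in C) [set i | c i = t])).
  by apply: subset_card_le => i _; exists (c i).
by apply: bigcup_countable => // t _; apply: contrapT => /h.
Qed.

Lemma countable_range (T : Type) (A : set T) :
  countable A -> A !=set0 -> exists e : nat -> T, range e = A.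
Proof.
move=> /countable_injP[f finj] [a Aa].
have /boolp.choice[e eP] : forall n, exists x,
    A x /\ forall y, A y -> f y = n -> y = x.
  move=> n; have [[x [Ax <-]]|nx] := pselect (exists x, A x /\ f x = n).
    by exists x; split=> // y Ay; apply: finj; rewrite inE.
  by exists a; split=> // y Ay fy; case: nx; exists y.
exists e; apply/seteqP; split=> [_ [n _ <-]|x Ax]; first by have [] := eP n.
by exists (f x) => //; have [_ /(_ x Ax erefl)] := eP (f x).
Qed.

(** * Lindelof subspaces and first countability *)

Lemma lindelof_subspace_nbhs (X : topologicalType) (L : set X) (N : X -> set X) :
  lindelof_subspace L -> (forall y, open_nbhs y (N y)) ->
  exists2 E, countable E & L `<=` \bigcup_(y in E) N y.
Proof.
move=> L_lind yN.
have [||F [Fsub cF LF]] := L_lind [set L `&` N y | y in L].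
- by move=> _ [y _ <-]; exists (N y) => //; have [] := yN y.
- by move=> y Ly; exists (L `&` N y); [exists y | split=> //; have [] := yN y].
have [[V0 FV0]|F0] := pselect (F !=set0); last first.
  exists set0 => // y /LF[V FV]; by case: F0; exists V.
have [e eF] := countable_range cF (ex_intro _ V0 FV0).
have /boolp.choice[g gP] : forall n, exists y, e n = L `&` N y.
  by move=> n; have /Fsub[y _ <-] : F (e n) by [rewrite -eF; exists n]; exists y.
exists (range g); first exact: sub_countable (card_image_le _ _) _.
move=> y /LF[V]; rewrite -eF => -[n _ <-]; rewrite gP => -[_ Ny].
by exists (g n) => //; exists n.
Qed.

Lemma first_countable_decreasing_basis (X : topologicalType) :
  first_countable X -> exists b : X -> nat -> set X,
    [/\ forall x n, open_nbhs x (b x n),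
        forall x m n, (m <= n)%N -> b x n `<=` b x m &
        forall x U, nbhs x U -> exists n, b x n `<=` U].
Proof.
move=> X_fc.
have /boolp.choice[b bP] : forall x, exists b : nat -> set X,
    [/\ forall n, open_nbhs x (b n), forall m n, (m <= n)%N -> b n `<=` b m &
        forall U, nbhs x U -> exists n, b n `<=` U].
  move=> x; have [B cB [Bx Bbase]] := X_fc x.
  have [|e eB] := countable_range cB.
    by have [V BV _] := Bbase setT filterT; exists V.
  pose b := fix b n := if n is m.+1 then b m `&` e n else e 0.
  have xe n : open_nbhs x (e n) by apply: Bx; rewrite -eB; exists n.
  have be n : b n `<=` e n by case: n => [|n] //=; exact: subIsetr.
  exists b; split.
  - by elim=> [|n IH] //=; exact: open_nbhsI.
  - by move=> m n /subnK <-; elim: (n - m)%N => [|k IH]//= y [/IH].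
  - move=> U /Bbase[V]; rewrite -eB => -[n _ <-] enU; exists n.
    exact: subset_trans enU.
by exists b; split=> [x|x|x]; have [] := bP x.
Qed.

(** One term [x j] in each of the countably many basic neighbourhoods of [y] suffices, and countably
    many indices have a common strict upper bound. *)
Lemma closure_omega1_range (X : topologicalType) (I : Type)
    (lt : I -> I -> Prop) (x : I -> X) (y : X) :
  first_countable X -> omega1_order lt -> closure (range x) y ->
  exists i, closure (x @` [set j | lt j i]) y.
Proof.
move=> X_fc I_omega1 cly.
have [b [yb _ bbase]] := first_countable_decreasing_basis X_fc.
have /boolp.choice[j jP] : forall n, exists j, b y n (x j).
  by move=> n; have [_ [[j _ <-] ?]] := cly _ (open_nbhs_nbhs (yb y n)); exists j.
have [|i iP] := @countable_bounded I lt (range j) I_omega1.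
  exact: sub_countable (card_image_le _ _) _.
exists i => U /bbase[n bU]; exists (x (j n)); split; last exact/bU/jP.
by exists (j n) => //; apply: iP; exists n.
Qed.

(** * Monotonically normal spaces *)

Section MonotonicallyNormal.
Variables (X : topologicalType) (H : X -> set X -> set X).
Hypothesis X_T1 : accessible_space X.
Hypothesis H_nbhs : forall x U, open_nbhs x U ->
  [/\ open (H x U), H x U x & H x U `<=` U].
Hypothesis H_meet : forall x U y V, open_nbhs x U -> open_nbhs y V ->
  H x U `&` H y V !=set0 -> V x \/ U y.

Lemma H_open_nbhs x U : open_nbhs x U -> open_nbhs x (H x U).
Proof. by move=> /H_nbhs[]. Qed.

(** For [y] outside [U], let [V] be the complement of [x]: then [H y V] cannot meet [H x U]. *)
Lemma closure_H x U : open_nbhs x U -> closure (H x U) `<=` U.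
Proof.
move=> xU y clHy; apply: contrapT => nUy.
have yV : open_nbhs y (~` [set x]).
  split; first exact/closed_openC/accessible_closed_set1.
  by move=> /= yx; apply: nUy; rewrite yx; case: xU.
have [|/(_ erefl)[]|//] := H_meet xU yV.
exact/clHy/open_nbhs_nbhs/H_open_nbhs.
Qed.

(** If [y] lies in no [B x], every open [V] around [y] contains a point of [E]: [H y V] meets some
    [H x (B x)], which forces [x] into [V]. *)
Lemma closure_bigcup_H (E : set X) (B : X -> set X) :
  (forall x, open_nbhs x (B x)) ->
  closure (\bigcup_(x in E) H x (B x)) `<=` closure E `|` \bigcup_(x in E) B x.
Proof.
move=> xB y cly; have [|nBy] := pselect ((\bigcup_(x in E) B x) y).
  by right.
left=> U; rewrite nbhsE => -[V yV VU].
have [z [[x Ex Hxz] Hyz]] := cly _ (open_nbhs_nbhs (H_open_nbhs yV)).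
have [|/VU Ux|Bxy] := H_meet (xB x) yV; first by exists z.
- by exists x.
- by case: nBy; exists x.
Qed.

(** The sets [H (y i) (V i)] are pairwise disjoint and each meets [C], so picking points of [C] in
    them injects [Z] into [C]. *)
Lemma countable_discrete (I : Type) (Z : set I) (y : I -> X) (V : I -> set X)
    (C : set X) :
  countable C -> (forall i, Z i -> closure C (y i)) ->
  (forall i, Z i -> open_nbhs (y i) (V i)) ->
  (forall i j, Z i -> Z j -> V i (y j) -> i = j) -> countable Z.
Proof.
move=> cC Cy yV Vy.
have /boolp.choice[c cP] : forall i, exists c, Z i -> C c /\ H (y i) (V i) c.
  move=> i; have [Zi|nZi] := pselect (Z i); last by exists (y i).
  by have [c] := Cy i Zi _ (open_nbhs_nbhs (H_open_nbhs (yV i Zi))); exists c.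
have cinj : {in Z &, injective c}.
  move=> i j; rewrite !inE => Zi Zj cij.
  have [_ Hi] := cP i Zi; have [_ Hj] := cP j Zj.
  have [|/Vy->//|/Vy->//] := H_meet (yV i Zi) (yV j Zj).
  by exists (c i); split => //; rewrite cij.
rewrite -(eq_countable (inj_card_eq cinj)); apply: sub_countable cC.
by apply: subset_card_le => _ [i /cP[Cc _] <-].
Qed.

(* An uncountable sequence [y] with [y j] outside [B (y i)] for [i < j] would
   have uncountably many [H (y i) (H (y i) (B (y i)))] sharing a point of [C].
   For [i < j] among these, [y i] is in [H (y j) (B (y j))], whose closure omits
   the later points; hence the immediate successor of [j] is isolated. *)
Lemma closure_countable_lindelof (C : set X) (B : X -> set X) :
  countable C -> (forall x, open_nbhs x (B x)) ->
  exists2 E, countable E & closure C `<=` \bigcup_(x in E) B x.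
Proof.
move=> cC xB; apply: contrapT => noE.
have [I [lt I_omega1]] := omega1_exists.
have [|y yP] := @omega1_recursion I X lt
  (fun S x => closure C x /\ forall s, S s -> ~ B s x) I_omega1.
  move=> S cS; apply: contrapT => /forallNP noX; apply: noE.
  exists S => // x Cx; apply: contrapT => nBx; apply: (noX x); split=> // s Ss Bsx.
  by apply: nBx; exists s.
have Cy i : closure C (y i) by have [] := yP i.
have nB i j : lt i j -> ~ B (y i) (y j).
  by move=> ij; have [_] := yP j; apply; exists i.
have [lt_wf lt_trans lt_tri I_unc segC] := I_omega1.
pose N i := H (y i) (B (y i)); pose M i := H (y i) (N i).
have yN i : open_nbhs (y i) (N i) by exact: H_open_nbhs.
have yM i : open_nbhs (y i) (M i) by exact: H_open_nbhs.
have /boolp.choice[c cP] : forall i, exists c, C c /\ M i c.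
  by move=> i; have [c] := Cy i _ (open_nbhs_nbhs (yM i)); exists c.
have [t Z_unc] : exists t, ~ countable [set i | c i = t].
  by apply: (uncountable_fiber I_unc cC) => i; have [] := cP i.
set Z := [set i | c i = t] in Z_unc.
have yZN i j : Z i -> Z j -> lt i j -> N j (y i).
  move=> Zi Zj ij; have [|//|Nij] := H_meet (yN i) (yN j).
    by exists t; split; [rewrite -Zi|rewrite -Zj];
      [have [] := cP i|have [] := cP j].
  by have [_ _ /(_ _ Nij)/nB] := H_nbhs (xB (y i)).
(* [s i] is the successor of [i] within [Z]; without later elements, [Z] would lie in a countable
   segment. *)
have /boolp.choice[s sP] : forall i, exists s, Z i ->
    [/\ Z s, lt i s & forall j, Z j -> lt i j -> ~ lt j s].
  move=> i; have [Zi|nZi] := pselect (Z i); last by exists i.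
  have [|s [Zs i_s] smin] :=
      @well_founded_minimal I lt [set j | Z j /\ lt i j] lt_wf.
    apply: contrapT => noj; apply: Z_unc.
    apply: (@sub_countable _ _ _ ([set j | lt j i] `|` [set i]));
      last exact: countableU.
    apply: subset_card_le => j Zj; case: (lt_tri i j) => [ij|->|];
      [|by right|by left].
    by case: noj; exists j.
  by exists s => _; split=> // j Zj ij; apply: smin.
apply: Z_unc.
(* If [i < j], then [s i <= j < s j], so [B (y (s i))] omits [y (s j)]. If [j < i], then [s j <= i],
   so [y (s j)] lies in [N i]. *)
apply: (@countable_discrete I Z (y \o s)
  (fun i => B (y (s i)) `&` ~` closure (N i)) C cC).
- by move=> i _; exact: Cy.
- move=> i /sP[_ i_s _]; have [oB Bys] := xB (y (s i)).
  split; first by apply: openI => //; exact/closed_openC/closed_closure.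
  by split=> // /(closure_H (xB _)); exact: nB.
- move=> i j Zi Zj [/= Bij nNij]; have [Zsi i_si simin] := sP i Zi.
  have [Zsj j_sj sjmin] := sP j Zj.
  case: (lt_tri i j) => // ij; exfalso.
  + apply: (nB _ _ _ Bij); case: (lt_tri (s i) j) => [/lt_trans|->//|].
      by apply.
    by move=> /(simin j Zj ij).
  + apply: nNij; apply: subset_closure; case: (lt_tri (s j) i) => [|->|].
    * exact: yZN.
    * by case: (yN i).
    * by move=> /(sjmin i Zi ij).
Qed.

(* If [B] has no countable subcover, recursion along omega_1 gives points [x i]
   and open sets [O i], countable unions of sets [H z (B z)], such that [O i]
   contains the closure of [x j] for [j <= i], and [x i] is outside the closure
   of the union [U i] of the [O j] for [j < i].  A point of the closure of
   [range x] lies in some [O j]; hence a Lindelof [L] meeting all the disjoint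
   [H (x i) (O i \ closure (U i))] meets them within countably many [O j]. *)
Lemma cellular_lindelof_countable_subcover (B : X -> set X) :
  cellular_lindelof X -> first_countable X -> (forall x, open_nbhs x (B x)) ->
  exists2 E, countable E & [set: X] = \bigcup_(x in E) B x.
Proof.
move=> X_cl X_fc xB; apply: contrapT => noE.
pose O (e : nat -> X) := \bigcup_n H (e n) (B (e n)).
have O_open e : open (O e).
  by apply: bigcup_open => n _; have [] := H_nbhs (xB (e n)).
have [I [lt I_omega1]] := omega1_exists.
(* A stage pairs the point [x i] with a sequence of centres whose shrunk neighbourhoods make up
   [O i]. *)
have [|t tP] := @omega1_recursion I (X * (nat -> X))%type lt
  (fun S t => ~ closure (\bigcup_(s in S) O s.2) t.1 /\
              closure (fst @` S `|` [set t.1]) `<=` O t.2) I_omega1.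
  move=> S cS; pose E0 := \bigcup_(s in S) range s.2.
  have cE0 : countable E0.
    apply: bigcup_countable => // s _.
    exact: sub_countable (card_image_le _ _) _.
  have [E1 cE1 E0E1] := closure_countable_lindelof cE0 xB.
  (* Avoiding the members centred in [E1] keeps [x] off the closure of [E0]; avoiding also those
     centred in [E0], it stays outside the closure of the earlier open sets by
     [closure_bigcup_H]. *)
  have [x nx] : exists x, ~ (\bigcup_(z in E0 `|` E1) B z) x.
    apply/existsNP => allx; apply: noE.
    exists (E0 `|` E1); first exact: countableU.
    by apply/seteqP; split.
  have cSx : countable (fst @` S `|` [set x]).
    by apply: countableU => //; exact: sub_countable (card_image_le _ _) cS.
  have [E cE SE] :=
    closure_countable_lindelof cSx (fun z => H_open_nbhs (xB z)).
  have [|e eE] := countable_range cE.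
    by have [z Ez _] := SE x (subset_closure (or_intror erefl)); exists z.
  exists (x, e); split=> /=; last first.
    move=> z /SE[w]; rewrite -eE => -[n _ <-] Hz; exists n => //.
  have -> : \bigcup_(s in S) O s.2 = \bigcup_(z in E0) H z (B z).
    apply/seteqP; split=> z.
      by move=> [s Ss [n _ Hz]]; exists (s.2 n) => //; exists s => //; exists n.
    by move=> [_ [s Ss [n _ <-]] Hz]; exists s => //; exists n.
  move=> /(closure_bigcup_H xB)[/E0E1|] [z Ez Bzx]; apply: nx; exists z => //.
    by right.
  by left.
have [lt_wf lt_trans lt_tri I_unc segC] := I_omega1.
pose x i := (t i).1; pose Oi i := O (t i).2.
pose U i := \bigcup_(j in [set j | lt j i]) Oi j.
have OU j i : lt j i -> Oi j `<=` U i by move=> ji z Oz; exists j.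
have xU i : ~ closure (U i) (x i).
  have [+ _] := tP i; apply: contra_not; apply: closureS => z [j ji Oz].
  by exists (t j) => //; exists j.
have clO i : closure (x @` [set j | lt j i] `|` [set x i]) `<=` Oi i.
  have [_ +] := tP i; apply: subset_trans; apply: closureS => z [[j ji <-]|->].
    by left; exists (t j) => //; exists j.
  by right.
have xO i : Oi i (x i) by apply/clO/subset_closure; right.
pose V i := Oi i `&` ~` closure (U i).
have xV i : open_nbhs (x i) (V i).
  split; last by split; [exact: xO|exact: xU].
  by apply: openI; [exact: O_open | exact/closed_openC/closed_closure].
have xNV i j : lt i j -> ~ V i (x j) /\ ~ V j (x i).
  move=> ij; split=> -[].
    by move=> Oix _; apply/(xU j)/subset_closure; exists i.
  by move=> _; apply; apply: subset_closure; exists i.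
pose G i := H (x i) (V i).
have Gdisj i j : G i `&` G j !=set0 -> i = j.
  move=> Gij; case: (lt_tri i j) => // /xNV[nij nji].
    by have [/nji|/nij] := H_meet (xV i) (xV j) Gij.
  by have [/nij|/nji] := H_meet (xV i) (xV j) Gij.
have [|L L_lind LG] := X_cl (range G).
  split=> [_ [i _ <-]|].
    by have [oG Gx _] := H_nbhs (xV i); split=> //; exists (x i).
  by move=> _ _ [i _ <-] [j _ <-] /= /Gdisj ->.
have clx y : closure (range x) y -> exists i, Oi i y.
  move=> /(closure_omega1_range X_fc I_omega1)[i cly]; exists i; apply: clO.
  by apply: closureS cly; exact: subsetUl.
(* A point [y] in no [Oi i] is outside the closure of [range x]. Shrinking the complement of that
   closure by [H] then gives a neighbourhood missing every [G i]. *)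
have /boolp.choice[N NP] : forall y, exists N, open_nbhs y N /\
    ((exists i, N = Oi i) \/ forall i, ~ (N `&` G i !=set0)).
  move=> y; have [[i Oy]|nO] := pselect (exists i, Oi i y).
    by exists (Oi i); split; [split=> //; exact: O_open|left; exists i].
  have yN : open_nbhs y (~` closure (range x)).
    by split; [exact/closed_openC/closed_closure|move=> /clx].
  exists (H y (~` closure (range x))); split; first exact: H_open_nbhs.
  right=> i /(H_meet yN (xV i))[[Oy _]|]; first by apply: nO; exists i.
  by apply; apply: subset_closure; exists i.
have [|E cE LE] := lindelof_subspace_nbhs L_lind (N := N).
  by move=> y; have [] := NP y.
have [i0 _] : exists i : I, True.
  apply: contrapT => noI; apply: I_unc.
  apply: (@sub_countable _ I _ set0) => //.
  by apply: subset_card_le => i _; case: noI; exists i.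
have /boolp.choice[a aP] : forall y, exists i,
    N y = Oi i \/ forall i, ~ (N y `&` G i !=set0).
  move=> y; have [_ [[i Ni]|nG]] := NP y; first by exists i; left.
  by exists i0; right.
(* [k] lies beyond every stage used to cover [L], so [G k] misses the whole cover although it meets
   [L]. *)
have [|k kP] := @countable_bounded I lt (a @` E) I_omega1.
  exact: sub_countable (card_image_le _ _) cE.
have [l [Gl Ll]] : G k `&` L !=set0 by apply: LG; exists k.
have [y Ey Ny] := LE l Ll.
have [NO|/(_ k)] := aP y; last by apply; exists l.
have [_ _ /(_ _ Gl)[_]] := H_nbhs (xV k); apply; apply: subset_closure.
by exists (a y); [apply: kP; exists y|rewrite -NO].
Qed.
End MonotonicallyNormal.

(** * The cardinality bound for Lindelof first-countable Hausdorff spaces *)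

(** Formal terms for the points generated from a base point: [Limit] for limits of sequences, [Node]
    for points outside a union of basic sets with centres [s n] and indices [k n]. Counting terms
    bounds the number of generated points. *)
Inductive countable_tree :=
| Leaf
| Limit of nat -> countable_tree
| Node of (nat -> nat) & (nat -> countable_tree).

(* A tree is determined by the labels read along its finite branches. *)
Fixpoint branch_labels (t : countable_tree) (q : seq nat * (nat * nat)) :
    Prop :=
  match t, q.1 with
  | Leaf, _ => False
  | Limit _, [::] => q.2 = (0, 0)
  | Limit s, i :: p => branch_labels (s i) (p, q.2)
  | Node k _, [::] => exists n, q.2 = (n.+1, k n)
  | Node _ s, i :: p => branch_labels (s i) (p, q.2)
  end.

(** The labels at the empty path identify the root: none for [Leaf], [(0, 0)] for [Limit], the graph
    of [k] shifted by one for [Node]. Those along paths starting with [i] determine the [i]-th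
    subtree. *)
Lemma branch_labels_inj : injective branch_labels.
Proof.
elim=> [|s IH|k s IH] [|s'|k' s'] //= E.
- by have := congr1 (@^~ ([::], (0, 0))) E => /= {}E; exfalso; rewrite E.
- have := congr1 (@^~ ([::], (1, k' 0))) E => /= {}E; exfalso; rewrite E.
  by exists 0.
- by have := congr1 (@^~ ([::], (0, 0))) E => /= {}E; exfalso; rewrite -E.
- congr Limit; apply: funext => i; apply: IH; apply: funext => -[p q].
  exact: (congr1 (@^~ (i :: p, q)) E).
- have := congr1 (@^~ ([::], (0, 0))) E => /= {}E.
  by suff [] : exists n, (0, 0) = (n.+1, k' n) by []; rewrite -E.
- have := congr1 (@^~ ([::], (1, k 0))) E => /= {}E; exfalso; rewrite -E.
  by exists 0.
- have := congr1 (@^~ ([::], (0, 0))) E => /= {}E.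
  by suff [] : exists n, (0, 0) = (n.+1, k n) by []; rewrite E.
- congr Node; last first.
    apply: funext => i; apply: IH; apply: funext => -[p q].
    exact: (congr1 (@^~ (i :: p, q)) E).
  apply: funext => n; have := congr1 (@^~ ([::], (n.+1, k n))) E => /= {}E.
  have : exists m, (n.+1, k n) = (m.+1, k' m) by rewrite -E; exists n.
  by move=> [m [-> ->]].
Qed.

Lemma card_countable_tree : [set: countable_tree] #<= [set: set nat].
Proof.
apply/pcard_injP; exists (fun t => [set pickle q | q in branch_labels t]).
move=> s t _ _ E; apply: branch_labels_inj.
have sub u v : [set pickle q | q in branch_labels u] `<=`
    [set pickle q | q in branch_labels v] ->
    branch_labels u `<=` branch_labels v.
  move=> uv q uq; have [|r vr /(pcan_inj pickleK) <-//] := uv (pickle q).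
  by exists q.
by apply/seteqP; split; apply: sub; rewrite E.
Qed.

(* The least set containing a point and closed under limits of sequences and
   under choosing a point outside a union of countably many basic open sets
   that do not cover the space is, by the Lindelof property, the whole space. *)
Lemma card_lindelof_first_countable (X : topologicalType) :
  hausdorff_space X -> first_countable X ->
  (forall B : X -> set X, (forall x, open_nbhs x (B x)) ->
     exists2 E, countable E & [set: X] = \bigcup_(x in E) B x) ->
  [set: X] #<= [set: set nat].
Proof.
move=> X_T2 X_fc X_lind.
have [b [xb b_decr bbase]] := first_countable_decreasing_basis X_fc.
have [[x0 _]|X0] := pselect ([set: X] !=set0); last first.
  suff -> : [set: X] = set0 by [].
  by apply/seteqP; split=> x // _; apply: X0; exists x.
(* Hausdorffness makes the limit unique; other sequences get the default [x0]. *)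
have /boolp.choice[lim limP] : forall s : nat -> X, exists z,
    forall y, (forall n, b y n (s n)) -> z = y.
  move=> s; have [[y ys]|nys] := pselect (exists y, forall n, b y n (s n));
    last first.
    by exists x0 => y ys; case: nys; exists y.
  exists y => z zs; apply: X_T2 => U V /bbase[m yU] /bbase[n zV].
  exists (s (maxn m n)); split.
    by apply/yU/(b_decr _ _ (maxn m n)); [exact: leq_maxl|exact: ys].
  by apply/zV/(b_decr _ _ (maxn m n)); [exact: leq_maxr|exact: zs].
have /boolp.choice[out outP] : forall ks : (nat -> nat) * (nat -> X), exists z,
    forall p, ~ (\bigcup_n b (ks.2 n) (ks.1 n)) p ->
    ~ (\bigcup_n b (ks.2 n) (ks.1 n)) z.
  move=> ks; have [[p np]|nop] :=
      pselect (exists p, ~ (\bigcup_n b (ks.2 n) (ks.1 n)) p).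
    by exists p.
  by exists x0 => p np; case: nop; exists p.
pose val := fix val t := match t with
  | Leaf => x0
  | Limit s => lim (fun n => val (s n))
  | Node k s => out (k, fun n => val (s n))
  end.
suff -> : [set: X] = range val.
  exact: card_le_trans (card_image_le _ _) card_countable_tree.
apply/seteqP; split=> // p _; apply: contrapT => nAp.
have A_closed y : closure (range val) y -> range val y.
  move=> cly; have /boolp.choice[s sP] : forall n, exists t, b y n (val t).
    move=> n; have [_ [[t _ <-] ?]] := cly _ (open_nbhs_nbhs (xb y n)).
    by exists t.
  by exists (Limit s) => //=; exact: limP.
have /boolp.choice[k kP] : forall y, exists k, y <> p -> ~ b y k p.
  move=> y; have [->|yp] := pselect (y = p); first by exists 0.
  have [|k bk] := bbase y (~` [set p]).
    apply: open_nbhs_nbhs; split; last exact.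
    exact/closed_openC/accessible_closed_set1/hausdorff_accessible.
  by exists k => _ /bk; exact.
(* Members centred in [range val] omit [p]; all others miss [range val], so only centres inside it
   help to cover it. *)
pose B y := if pselect (range val y) then b y (k y) else ~` closure (range val).
have yB y : open_nbhs y (B y).
  rewrite /B; case: pselect => [Ay|nAy]; first exact: xb.
  by split; [exact/closed_openC/closed_closure|move=> /A_closed].
have [E cE EB] := X_lind B yB.
have BA y z : range val z -> B y z -> range val y.
  move=> Az; rewrite /B; case: pselect => // nAy; apply: contra_notP => _.
  exact: subset_closure.
have [y Ey By] : (\bigcup_(y in E) B y) x0 by rewrite -EB.
have [||e eE] := @countable_range X (E `&` range val).
- by apply: sub_countable cE; apply: subset_card_le; exact: subIsetl.
- by exists y; split=> //; apply: BA By; exists Leaf.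
have /boolp.choice[s sP] : forall n, exists t, val t = e n.
  move=> n; have [_ [t _ te]] : (E `&` range val) (e n) by rewrite -eE; exists n.
  by exists t.
have Bs n : b (val (s n)) (k (val (s n))) = B (val (s n)).
  by rewrite /B; case: pselect => // -[]; exists (s n).
(* Since [p] is in none of the members centred at the [val (s n)], [out] yields a point [q] of
   [range val] that they all miss. *)
pose q := val (Node (fun n => k (val (s n))) s).
have Aq : range val q by exists (Node (fun n => k (val (s n))) s).
have nBq : ~ (\bigcup_n b (val (s n)) (k (val (s n)))) q.
  apply: (@outP (_, _) p) => -[n _]; apply: kP => snp; apply: nAp; rewrite -snp.
  by exists (s n).
have [z Ez Bz] : (\bigcup_(y in E) B y) q by rewrite -EB.
have [n _ zn] : range e z by rewrite eE; split=> //; exact: BA Bz.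
by apply: nBq; exists n => //; rewrite Bs sP zn.
Qed.

Theorem corollary11 (X : topologicalType)
    (X_hausdorff : hausdorff_space X)
    (X_mn : monotonically_normal X)
    (X_cl : cellular_lindelof X)
    (X_fc : first_countable X) :
  [set: X] #<= [set: set nat].
Proof.
apply: card_lindelof_first_countable => // B xB.
have [H [H_nbhs H_meet]] := X_mn.
have X_T1 := hausdorff_accessible X_hausdorff.
exact: (cellular_lindelof_countable_subcover X_T1 H_nbhs H_meet X_cl X_fc xB).
Qed.
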